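(* Let $G$ be a connected (bull, chair)-free graph. Then $\mathsf{lpt}(G) \le 5$.
   Context: All graphs are finite and simple. A chair is the graph obtained by subdividing one edge of the claw $K_{1,3}$ exactly once. A bull is the graph obtained from a four-vertex path by adding a vertex adjacent to exactly the two middle vertices of the path. A graph is (bull, chair)-free if it has no induced subgraph isomorphic to a bull or a chair. A longest path of a connected graph $G$ is a path of maximum length in $G$; a longest path transversal is a set of vertices meeting every longest path; $\mathsf{lpt}(G)$ is the minimum cardinality of a longest path transversal of $G$. *)

(* Defs.v *)
From mathcomp Require Import all_boot.
Set Implicit Arguments. Unset Strict Implicit. Unset Printing Implicit Defensive.

Definition simple_graph (T : finType) (e : rel T) : Prop :=
  symmetric e /\ irreflexive e.

Definition connected_graph (T : finType) (e : rel T) : Prop :=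
  forall x y : T, connect e x y.

Definition induced_sub (k : nat) (h : rel 'I_k) (T : finType) (e : rel T) : Prop :=
  exists f : 'I_k -> T, injective f /\ forall i j, e (f i) (f j) = h i j.

Definition edge_list (k : nat) (l : seq (nat * nat)) : rel 'I_k :=
  fun i j => ((nat_of_ord i, nat_of_ord j) \in l) || ((nat_of_ord j, nat_of_ord i) \in l).

(* Chair: claw with center 0 and leaves 1,2,3, edge 0-3 subdivided by 4. *)
Definition chair : rel 'I_5 := @edge_list 5 [:: (0,1); (0,2); (0,4); (4,3)].
Definition bull : rel 'I_5 := @edge_list 5 [:: (0,1); (1,2); (2,3); (4,1); (4,2)].

Definition bull_chair_free (T : finType) (e : rel T) : Prop :=
  ~ induced_sub bull e /\ ~ induced_sub chair e.

Definition is_path (T : finType) (e : rel T) (s : seq T) : Prop :=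
  match s with
  | [::] => False
  | x :: s' => path e x s' && uniq s
  end.

Definition path_length (T : Type) (s : seq T) : nat := (size s).-1.

Definition longest_path (T : finType) (e : rel T) (s : seq T) : Prop :=
  is_path e s /\ forall t, is_path e t -> path_length t <= path_length s.

Definition lp_transversal (T : finType) (e : rel T) (S : {set T}) : Prop :=
  forall s, longest_path e s -> exists2 x, x \in S & x \in s.

Definition lpt_le (T : finType) (e : rel T) (k : nat) : Prop :=
  exists S : {set T}, #|S| <= k /\ lp_transversal e S.

(* Main.v *)
(* A dominating set meets every longest path P: an end of P outside the set has
   a neighbour in it, and if that neighbour were off P it would extend P.

   If G has a claw C, excluding bulls and chairs puts every vertex within
   distance 2 of C.  Either one neighbour of C is adjacent to all the vertices
   at distance 2, and together with C dominates G, or two neighbours x, x' of C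
   have private neighbours at distance 2; then x and x' are complete to C, and
   if x is chosen with the most neighbours at distance 2, then x, x' and the
   center of C dominate G.

   If G has no claw, a longest path P is Hamiltonian.  Otherwise take v off P
   adjacent to w on P and grow a subpath M of P from w, always at the end that
   is nearer to v in G[v + M].  This graph remains a chain of cliques starting
   at v, so it has a Hamiltonian path from v to the farther end of M.  If v
   were adjacent to the next vertex of P, or if P ended there, this path could
   replace M in P and give a longer path. *)
Require Import Defs.
From mathcomp Require Import all_boot.

Set Implicit Arguments.
Unset Strict Implicit.
Unset Printing Implicit Defensive.

(* Distinctness of two vertices, from a vertex adjacent to only one of them. *)
Ltac clash_neighbours :=
  match goal with
  | E : ?a = ?b, H1 : is_true (?e ?a ?k), H2 : ?e ?b ?k = false |- _ =>
      by move: H2; rewrite -E H1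
  | E : ?a = ?b, H1 : is_true (?e ?b ?k), H2 : ?e ?a ?k = false |- _ =>
      by move: H2; rewrite E H1
  | E : ?a = ?b, H : ?a <> ?b |- _ => by case: H
  | E : ?a = ?b, H : ?b <> ?a |- _ => by case: H
  end.

(** * Longest paths and forbidden subgraphs, in terms of adjacency *)

Section BullChairFree.

Variables (T : finType) (e : rel T).
Hypotheses (e_sym : symmetric e) (e_irr : irreflexive e).

Local Ltac by_adjacency := first [assumption | rewrite e_sym; assumption].

Lemma dominating_lp_transversal (S : {set T}) :
  (forall u, exists2 s, s \in S & (u == s) || e u s) -> lp_transversal e S.
Proof.
move=> domS [|x p] [//= /andP[px Ux] maxp].
have [s sS /orP[/eqP->|xs]] := domS x; first by exists s => //; rewrite mem_head.
exists s => //; apply: contraT => sNp.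
by have := maxp (s :: x :: p); rewrite /= sNp e_sym xs px Ux ltnn => /(_ isT).
Qed.

Lemma bull_freeP : ~ induced_sub bull e -> forall p0 p1 p2 p3 q,
  e p0 p1 -> e p1 p2 -> e p2 p3 -> e q p1 -> e q p2 ->
  ~~ e p0 p2 -> ~~ e p0 p3 -> ~~ e p1 p3 -> ~~ e q p0 -> ~~ e q p3 -> False.
Proof.
move=> bullN p0 p1 p2 p3 q e01 e12 e23 eq1 eq2.
move=> /negbTE n02 /negbTE n03 /negbTE n13 /negbTE nq0 /negbTE nq3.
have [e10 e21 e32] : [/\ e p1 p0, e p2 p1 & e p3 p2] by split; rewrite e_sym.
have [e1q e2q] : e p1 q /\ e p2 q by split; rewrite e_sym.
have [n20 n30 n31] : [/\ e p2 p0 = false, e p3 p0 = false & e p3 p1 = false].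
  by split; rewrite e_sym.
have [n0q n3q] : e p0 q = false /\ e p3 q = false by split; rewrite e_sym.
apply: bullN; exists (fun i => nth p0 [:: p0; p1; p2; p3; q] i); split.
  have := (e_irr p0, e_irr p1, e_irr p2, e_irr p3, e_irr q).
  move=> [[[[i0 i1] i2] i3] i4].
  by move=> [[|[|[|[|[|//]]]]] ?] [[|[|[|[|[|//]]]]] ?] /= E;
    first [exact: val_inj | clash_neighbours].
by move=> [[|[|[|[|[|//]]]]] ?] [[|[|[|[|[|//]]]]] ?] /=; rewrite ?e_irr.
Qed.

(** [b] and [c] are twins in the chair, so adjacency cannot separate them and [b != c] is assumed.
    Any other two vertices, like any two vertices of the bull, have different neighbourhoods. *)
Lemma chair_freeP : ~ induced_sub chair e -> forall x b c y z, b != c ->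
  e x b -> e x c -> e x y -> e y z ->
  ~~ e b c -> ~~ e b y -> ~~ e c y -> ~~ e x z -> ~~ e b z -> ~~ e c z -> False.
Proof.
move=> chairN x b c y z /eqP bc xb xc xy yz.
move=> /negbTE nbc /negbTE nby /negbTE ncy /negbTE nxz /negbTE nbz /negbTE ncz.
have [bx cx yx zy] : [/\ e b x, e c x, e y x & e z y] by split; rewrite e_sym.
have [ncb nyb nyc] : [/\ e c b = false, e y b = false & e y c = false].
  by split; rewrite e_sym.
have [nzx nzb nzc] : [/\ e z x = false, e z b = false & e z c = false].
  by split; rewrite e_sym.
apply: chairN; exists (fun i => nth x [:: x; b; c; z; y] i); split.
  have := (e_irr x, e_irr b, e_irr c, e_irr y, e_irr z).
  move=> [[[[i0 i1] i2] i3] i4].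
  by move=> [[|[|[|[|[|//]]]]] ?] [[|[|[|[|[|//]]]]] ?] /= E;
    first [exact: val_inj | clash_neighbours].
by move=> [[|[|[|[|[|//]]]]] ?] [[|[|[|[|[|//]]]]] ?] /=; rewrite ?e_irr.
Qed.

(** * Claw-free graphs: chains of cliques and Hamiltonian paths *)

Definition claw (a b c d : T) : bool :=
  [&& e a b, e a c, e a d, b != c, b != d, c != d,
      ~~ e b c, ~~ e b d & ~~ e c d].

Hypothesis bullF : forall p0 p1 p2 p3 q,
  e p0 p1 -> e p1 p2 -> e p2 p3 -> e q p1 -> e q p2 ->
  ~~ e p0 p2 -> ~~ e p0 p3 -> ~~ e p1 p3 -> ~~ e q p0 -> ~~ e q p3 -> False.

(* The sets {l = 0} = {v}, {l = 1} = {w}, {l = 2}, ... partition X into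
   nonempty cliques; consecutive ones are completely joined, others are not
   adjacent at all. *)
Definition clique_chain (v w : T) (l : T -> nat) (X : {set T}) : Prop :=
  [/\ {in X, forall x, l x = 0 -> x = v},
      {in X, forall x, l x = 1 -> x = w},
      {in X, forall x n, l x = n.+1 -> exists2 y, y \in X & l y = n} &
      {in X &, forall x y, e x y = [&& x != y, l x <= (l y).+1 & l y <= (l x).+1]}].

Lemma clique_chain_lower v w l X x n : clique_chain v w l X ->
  x \in X -> n <= l x -> exists2 y, y \in X & l y = n.
Proof.
move=> [_ _ lS _] xX; move def_m: (l x) => m.
elim: m x xX def_m => [|m IHm] x xX def_m.
  by rewrite leqn0 => /eqP->; exists x.
rewrite leq_eqVlt => /predU1P[->|]; first by exists x.
by have [y yX ly] := lS x xX m def_m; apply: IHm ly.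
Qed.

Lemma clique_chain_hamiltonian v w l X q : clique_chain v w l X -> q \in X ->
  {in X, forall x, l x <= l q} ->
  exists s, [/\ path e v s, last v s = q, uniq (v :: s) & v :: s =i X].
Proof.
elim/ltn_ind: {X}#|X| {-2}X (erefl #|X|) q => m IHm X cardX q chX qX topq.
have [l0 l1 lS eX] := chX.
have [lq0|lq0] := posnP (l q).
  exists [::]; split => //=; first by rewrite (l0 q).
  move=> x; rewrite inE; apply/eqP/idP => [->|xX]; first by rewrite -(l0 q).
  by apply: l0 => //; apply/eqP; rewrite -leqn0 -lq0 topq.
have chY : clique_chain v w l (X :\ q).
  split=> [x|x|x|x y]; rewrite ?in_setD1 => /andP[xq xX]; auto.
    move=> n lx; have [y yX ly] := lS x xX n lx; exists y => //.
    rewrite !inE yX andbT; apply/eqP => yq.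
    by have := topq x xX; rewrite lx -ly yq ltnn.
  by case/andP=> _ yX; rewrite eX.
have [p pX lp] := clique_chain_lower chX qX (leq_pred _).
(* [p] lies one level below [q] and survives its removal, so the top vertex [r] of the rest is at
   most one level below [q], hence adjacent to it. *)
have pY : p \in X :\ q.
  by rewrite !inE pX andbT; apply/eqP => pq; move: lq0; rewrite -ltn_predL -lp pq ltnn.
case: (arg_maxnP l pY) => r rY topr.
have rX : r \in X by case/setD1P: rY.
have rq : r != q by case/setD1P: rY.
have cardY : #|X :\ q| < m by rewrite -cardX [#|X|](cardsD1 q) qX.
have [s [ps lasts Us sY]] := IHm _ cardY _ (erefl _) r chY rY topr.
have qNs : q \notin v :: s by rewrite sY !inE eqxx.
exists (rcons s q); split=> [|||x].
- rewrite rcons_path ps lasts eX // rq (leqW (topq _ _)) //=.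
  by rewrite -(prednK lq0) -lp ltnS; apply: topr.
- exact: last_rcons.
- by rewrite -rcons_cons rcons_uniq qNs.
- rewrite -rcons_cons mem_rcons inE sY !inE.
  by have [->|] := eqVneq x q; rewrite ?qX.
Qed.

(** Let [u] be a neighbour of [z] of lowest level. The neighbours of [z] in [X] are then exactly the
    levels [l u] to [l u + 2], so [z] fits into level [l u + 1]. As [z] misses [v], this level is at
    least 2, and levels 0 and 1 stay singletons. *)
Lemma clique_chain_extend v w l X z x : (forall a b c d, ~~ claw a b c d) ->
  clique_chain v w l X -> z \notin X -> ~~ e z v -> x \in X -> e z x ->
  exists2 l', clique_chain v w l' (z |: X) & {in X, l' =1 l}.
Proof.
move=> clawN chX zX zv xX zx.
have [l0 l1 lS eX] := chX.
have ux : (x \in X) && e z x by rewrite xX.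
case: (@arg_minnP _ x (fun u => (u \in X) && e z u) l ux) => u /andP[uX zu] minu {ux}.
have lu : 0 < l u.
  by rewrite lt0n; apply: contraNneq zv => /(l0 u uX) <-.
have low y : y \in X -> l y < l u -> ~~ e z y.
  by move=> yX; apply: contraL => zy; rewrite -leqNgt minu ?yX.
have [t tX lt] := clique_chain_lower chX uX (leq_pred _).
have lu_t : l u = (l t).+1 by rewrite lt prednK.
have neqX y y' : l y != l y' -> y != y' by apply: contraNneq => ->.
have neqz y : y \in X -> y != z by apply: contraTneq => ->.
have adj y y' : y \in X -> y' \in X -> l y' = (l y).+1 -> e y y'.
  move=> yX y'X ll; rewrite eX // ll leqnn leqW // andbT neqX //.
  by rewrite ll neq_ltn leqnn.
have nadj y y' : y \in X -> y' \in X -> (l y).+1 < l y' -> ~~ e y y'.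
  by move=> yX y'X ll; rewrite eX // !negb_and -!ltnNge ll !orbT.
have tu : e t u by rewrite adj.
have zt : ~~ e z t by rewrite low // lu_t.
(* Otherwise [u] is the center of a claw with leaves [t], [c], [z]. *)
have z_succ c : c \in X -> l c = (l u).+1 -> e z c.
  move=> cX lc; apply: contraT => zc; have /negP[] := clawN u t c z.
  rewrite /claw e_sym tu adj // e_sym zu !neqz // neqX; last first.
    by rewrite lc lu_t neq_ltn leqW.
  by rewrite nadj ?lc ?lu_t // ![e _ z]e_sym zt zc.
have z_nbr y : y \in X -> e z y = (l u <= l y <= (l u).+2).
  move=> yX; case: (ltngtP (l u) (l y)) => [lt_uy|lt_yu|eq_uy] /=.
  - have [c cX lc] := clique_chain_lower chX yX lt_uy.
    have uc : e u c by rewrite adj.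
    have zc := z_succ c cX lc.
    have tc : ~~ e t c by rewrite nadj // lc lu_t.
    have ty : ~~ e t y by rewrite nadj // -lu_t.
    have [ly|ly|ly] := ltngtP (l y) (l u).+2.
    + by apply: z_succ => //; apply/eqP; rewrite eqn_leq -ltnS ly.
    + apply/negbTE/negP => zy.
      have uy : ~~ e u y by rewrite nadj // ltnW.
      have cy : ~~ e c y by rewrite nadj // lc.
      by apply: (@bullF t u z y c); by_adjacency.
    + apply: contraT => zy; exfalso.
      have uy : ~~ e u y by rewrite nadj // ly.
      have cy : e c y by rewrite adj // lc.
      by apply: (@bullF t u c y z); by_adjacency.
  - exact/negbTE/low.
  - rewrite -eq_uy leqW //; have [->//|yu] := eqVneq y u.
    (* Level 1 contains only [w], so a second vertex on the level of [u] forces that level to be at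
       least 2; this leaves room for [s] below [t]. *)
    have lt0 : 0 < l t.
      rewrite lt0n; apply: contraNneq yu => lt0.
      have lu1 : l u = 1 by rewrite lu_t lt0.
      by apply/eqP; rewrite (l1 u uX lu1); apply: l1; rewrite // -eq_uy.
    have [s sX ls] := clique_chain_lower chX tX (leq_pred _).
    have lt_s : l t = (l s).+1 by rewrite ls prednK.
    have st : e s t by rewrite adj.
    have su : ~~ e s u by rewrite nadj // lu_t lt_s.
    have sy : ~~ e s y by rewrite nadj // -eq_uy lu_t lt_s.
    have ty : e t y by rewrite adj // -eq_uy.
    have uy : e u y by rewrite eX // eq_sym yu -eq_uy leqnSn.
    have zs : ~~ e z s by rewrite low // lu_t lt_s.
    apply: contraT => zy; exfalso.
    by apply: (@bullF s t u z y); by_adjacency.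
exists (fun y => if y == z then (l u).+1 else l y); last first.
  by move=> y yX /=; rewrite (negbTE (neqz y yX)).
split=> [y|y|y|y y'].
- by case/setU1P => [->|yX]; rewrite ?eqxx // (negbTE (neqz y yX)); apply: l0.
- case/setU1P => [->|yX]; rewrite ?eqxx ?(negbTE (neqz y yX)); last exact: l1.
  by case=> lu0; rewrite lu0 in lu.
- case/setU1P => [->|yX] n; rewrite ?eqxx ?(negbTE (neqz y yX)).
    by case=> <-; exists u; rewrite ?inE ?uX ?orbT // (negbTE (neqz u uX)).
  case/lS=> // y' y'X ly'; exists y'; first by rewrite inE y'X orbT.
  by rewrite (negbTE (neqz y' y'X)).
- case/setU1P => [->|yX]; case/setU1P => [->|y'X].
  + by rewrite e_irr eqxx.
  + rewrite eqxx (negbTE (neqz y' y'X)) eq_sym (negbTE (neqz y' y'X)).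
    by rewrite z_nbr //= !ltnS.
  + rewrite eqxx (negbTE (neqz y yX)) e_sym z_nbr //=.
    by rewrite andbC !ltnS.
  + by rewrite (negbTE (neqz y yX)) (negbTE (neqz y' y'X)) eX.
Qed.

Lemma sorted_cat_last (x : T) s t : s != [::] ->
  sorted e (s ++ t) = sorted e s && path e (last x s) t.
Proof. by case: s => //= y s _; rewrite cat_path. Qed.

(** Induction on the part of the path outside [M]. The bound on [l] says that an end of [M] has top
    level, so a Hamiltonian path of the chain can run from [v] to that end and replace [M], unless
    the vertex next to the other end misses [v]; that vertex then joins [M]. The default [v] of
    [head] and [last] is never reached, as [M] is nonempty. *)
Lemma clique_chain_longer_path v w l A M B : (forall a b c d, ~~ claw a b c d) ->
  sorted e (A ++ M ++ B) -> uniq (v :: A ++ M ++ B) -> M != [::] ->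
  clique_chain v w l (v |: [set x in M]) ->
  {in v |: [set x in M], forall x, l x <= maxn (l (head v M)) (l (last v M))} ->
  exists s, [/\ sorted e s, uniq s & size s = (size (A ++ M ++ B)).+1].
Proof.
move=> clawN; move def_n: (size A + size B) => n.
elim/ltn_ind: n A M B l def_n => n IHn A M B l def_n sP uP M0 chX topX.
(* Reversing the path exchanges the two ends of M. *)
wlog le_ht : A M B def_n sP uP M0 chX topX / l (head v M) <= l (last v M).
  have [le_ht|/ltnW le_th] := leqP (l (head v M)) (l (last v M)); first exact.
  have rP : rev (A ++ M ++ B) = rev B ++ rev M ++ rev A.
    by rewrite !rev_cat catA.
  have eM : [set x in rev M] = [set x in M].
    by apply/setP => x; rewrite !inE mem_rev.
  have hM : head v (rev M) = last v M.
    by case/lastP: (M) => // M' y; rewrite rev_rcons last_rcons.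
  have lM : last v (rev M) = head v M.
    by case: (M) => // y M'; rewrite rev_cons last_rcons.
  rewrite -(size_rev (A ++ M ++ B)) rP => /(_ (rev B) (rev M) (rev A)); apply.
  - by rewrite !size_rev addnC.
  - have /eq_sorted ee : (fun z => e^~ z) =2 e by move=> x y; apply: e_sym.
    by rewrite -rP rev_sorted ee.
  - by rewrite -rP cons_uniq mem_rev rev_uniq.
  - by rewrite -size_eq0 size_rev size_eq0.
  - by rewrite eM.
  - by rewrite eM hM lM maxnC.
  - by rewrite hM lM.
rewrite (maxn_idPr le_ht) in topX.
have lastX : last v M \in v |: [set x in M].
  by rewrite !inE; case: (M) M0 => //= y M' _; rewrite mem_last orbT.
have [s [ps lasts us sX]] := clique_chain_hamiltonian chX lastX topX.
have psM : perm_eq (v :: s) (v :: M).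
  apply: uniq_perm => [//||x]; last by rewrite sX !inE.
  by move: uP; rewrite !cons_uniq !mem_cat !cat_uniq; do !case: (_ \in _);
     case/and3P=> // _ _ /and3P[].
have psP : perm_eq (A ++ (v :: s) ++ B) (v :: A ++ M ++ B).
  apply: (@perm_trans _ (A ++ (v :: M) ++ B)); first by rewrite perm_cat2l perm_cat2r.
  by rewrite (perm_catCA A [:: v] (M ++ B)).
have sB : path e v (s ++ B).
  have sMB : sorted e (M ++ B) by case/cat_sorted2: sP.
  by rewrite cat_path ps lasts; move: sMB; rewrite (sorted_cat_last v) // => /andP[].
have done_path : sorted e (A ++ (v :: s) ++ B) ->
  exists s, [/\ sorted e s, uniq s & size s = (size (A ++ M ++ B)).+1].
  by exists (A ++ (v :: s) ++ B); split=> //; rewrite ?(perm_uniq psP) ?(perm_size psP).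
case/lastP: A => [|A z] in def_n sP uP psP done_path *; first exact: done_path.
have [zv|zv] := boolP (e z v).
  apply: done_path; rewrite cat_rcons sorted_cat_cons /= zv sB.
  by move: sP; rewrite cat_rcons sorted_cat_cons => /andP[-> _].
rewrite cat_rcons -cat_cons; rewrite cat_rcons -cat_cons in uP sP.
have zX : z \notin v |: [set x in M].
  have : uniq (v :: z :: M).
    apply: subseq_uniq uP; rewrite /= eqxx.
    by apply: subseq_trans (suffix_subseq A _); apply: prefix_subseq.
  by rewrite /= !inE negb_or eq_sym => /and3P[/andP[/negbTE-> _] zM _].
have zM : e z (head v M).
  by case/cat_sorted2: sP => _; case: (M) M0 => //= y M' _ /andP[].
have hX : head v M \in v |: [set x in M].
  by rewrite !inE; case: (M) M0 => //= y M' _; rewrite mem_head orbT.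
have [l' chX' ll'] := clique_chain_extend clawN chX zX zv hX zM.
have eX : z |: (v |: [set x in M]) = v |: [set x in z :: M].
  by apply/setP=> x; rewrite !inE orbCA.
apply: (IHn _ _ A (z :: M) B l' erefl) => //; rewrite -?eX //.
  by rewrite -def_n size_rcons addSn.
have lz : last v (z :: M) = last v M by case: (M) M0.
(* Old levels are unchanged, so the top level is reached either by [z] or still by the last vertex
   of [M]. *)
rewrite lz => x /setU1P[->|xX]; first exact: leq_maxl.
by rewrite leq_max (ll' x) // (ll' (last v M)) // topX // orbT.
Qed.

Lemma claw_free_hamiltonian : connected_graph e ->
  (forall a b c d, ~~ claw a b c d) ->
  forall s, longest_path e s -> forall x, x \in s.
Proof.
move=> conn clawN s [is_s maxs] x; apply: contraT => xs.
have [sP us s0] : [/\ sorted e s, uniq s & s != [::]].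
  by case: s is_s {maxs xs} => [|y s] //= /andP[].
have [v vs [w wv ws]] : exists2 v, v \notin s & exists2 w, e w v & w \in s.
  (* If no edge left [s], its vertex set would be closed under adjacency, against connectedness. *)
  have [/exists_inP[v vs /exists_inP[w wv ws]]|none] :=
    boolP [exists v in [predC s], exists w in e^~ v, w \in s].
    by exists v => //; exists w.
  have [y ys] : exists y, y \in s.
    by case: (s) s0 => // y ? _; exists y; rewrite mem_head.
  have cl : closed e (mem s).
    apply: (intro_closed (sym_connect_sym e_sym)) => a b ab aS; apply: contraNT none => bS.
    by apply/exists_inP; exists b => //; apply/exists_inP; exists a.
  by rewrite -(closed_connect cl (conn y x)) ys in xs.
case/splitPr: ws sP us vs maxs {is_s s0 xs} => A B sP us vs maxs.
have wv' : w != v by apply: contraTneq wv => ->; rewrite e_irr.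
(* The initial chain has just the levels [{v}] and [{w}]. *)
pose l x : nat := x != v.
have [|||//|t [st ut]] := @clique_chain_longer_path v w l A [:: w] B clawN sP.
- by rewrite cons_uniq vs.
- by [].
- split=> [y|y|y|y z]; rewrite !inE.
  + by move=> _; rewrite /l; case: eqP.
  + by case/orP=> /eqP->; rewrite /l ?eqxx.
  + case/orP=> /eqP-> n; rewrite /l ?eqxx // wv' => -[<-].
    by exists v; rewrite ?inE eqxx.
  + by case/orP=> /eqP->; case/orP=> /eqP->;
      rewrite /l ?eqxx ?e_irr ?wv' ?[v == w]eq_sym ?wv' // e_sym.
- by move=> y _; rewrite /= maxnn /l wv' leq_b1.
case: t st ut => // y t st ut sz; have /maxs : is_path e (y :: t) by apply/andP.
by rewrite /path_length sz /= size_cat /= addnS ltnn.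
Qed.

(** * Graphs with a claw: a small dominating set *)

Hypothesis chairF : forall x b c y z, b != c ->
  e x b -> e x c -> e x y -> e y z ->
  ~~ e b c -> ~~ e b y -> ~~ e c y -> ~~ e x z -> ~~ e b z -> ~~ e c z -> False.

Section Claw.

Variables (a b c d : T).
Hypothesis abcd_claw : claw a b c d.

Let leaves := [:: b; c; d].

(** This includes the claw itself, each of whose vertices has a neighbour in it. *)
Definition near (u : T) : bool := has (e u) (a :: leaves).

Let a_leaf p : p \in leaves -> e a p.
Proof.
by case/and4P: abcd_claw => ab ac ad _; rewrite !inE => /or3P[] /eqP->.
Qed.

Let leafN p q : p \in leaves -> q \in leaves -> ~~ e p q.
Proof.
case/and5P: abcd_claw => _ _ _ _ /and5P[_ _ bc bd cd].
by rewrite !inE => /or3P[] /eqP-> /or3P[] /eqP->; rewrite ?e_irr // e_sym.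
Qed.

Let near_claw p : p \in a :: leaves -> near p.
Proof.
rewrite inE => /predU1P[->|pL]; apply/hasP.
  by exists b; rewrite ?a_leaf // !inE eqxx ?orbT.
by exists a; rewrite ?mem_head // e_sym a_leaf.
Qed.

Let far_claw y p : ~~ near y -> p \in a :: leaves -> ~~ e p y.
Proof. by move=> /hasPn/(_ p) farP pC; rewrite e_sym farP. Qed.

Let far_leaf y p : ~~ near y -> p \in leaves -> ~~ e p y.
Proof. by move=> fy pL; rewrite far_claw // inE pL orbT. Qed.

Let far_center y : ~~ near y -> ~~ e a y.
Proof. by move=> fy; rewrite far_claw // mem_head. Qed.

(** If [x] missed both, then [a], [p], [q] would form a chair with the leg [x], [y] when [x] sees
    [a], and with the leg [r], [x] through a leaf [r] seen by [x] otherwise. *)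
Lemma near_misses_one_leaf x y p q : near x -> ~~ near y -> e x y ->
  p \in leaves -> q \in leaves -> p != q -> e x p || e x q.
Proof.
move=> /hasP[r rC xr] fy xy pL qL pq; apply: contraT.
rewrite negb_or => /andP[xp xq]; exfalso.
have [[ap aq] npq] := (a_leaf pL, a_leaf qL, leafN pL qL).
have [[npy nqy] nay] := (far_leaf fy pL, far_leaf fy qL, far_center fy).
have [xa|xa] := boolP (e x a).
  by apply: (@chairF a p q x y); by_adjacency.
case/predU1P: rC xr => [->|rL xr]; first by rewrite (negbTE xa).
have [[ar npr] nqr] := (a_leaf rL, leafN pL rL, leafN qL rL).
by apply: (@chairF a p q r x); by_adjacency.
Qed.

(** If [x] missed [p], it would see another leaf [q], and the path [y], [x], [a], [p] with [q] would
    be a bull. *)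
Lemma near_center_leaf x y p : near x -> ~~ near y -> e x y -> e x a ->
  p \in leaves -> e x p.
Proof.
move=> nx fy xy xa pL; apply: contraT => xp; exfalso.
have [q qL pq] : exists2 q, q \in leaves & p != q.
  case/and5P: abcd_claw => _ _ _ bc _; have [->|pb] := eqVneq p b.
    by exists c; rewrite ?inE ?eqxx ?orbT.
  by exists b; rewrite ?inE ?eqxx.
have xq : e x q.
  by have := near_misses_one_leaf nx fy xy pL qL pq; rewrite (negbTE xp).
have [nya nyq] := (far_center fy, far_leaf fy qL).
have [[aq ap] qp] := (a_leaf qL, a_leaf pL, leafN qL pL).
have nyp := far_leaf fy pL.
by apply: (@bullF y x a p q); by_adjacency.
Qed.

Let two_leaves x y : near x -> ~~ near y -> e x y ->
  exists p q, [/\ p \in leaves, q \in leaves, p != q, e x p & e x q].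
Proof.
move=> nx fy xy; have m1 := near_misses_one_leaf nx fy xy.
case/and5P: abcd_claw => _ _ _ bc /and4P[bd cd _ _].
have [bL cL dL] : [/\ b \in leaves, c \in leaves & d \in leaves].
  by rewrite !inE !eqxx !orbT.
case xb: (e x b) (m1 b c bL cL bc) (m1 b d bL dL bd) (m1 c d cL dL cd) => /=.
  by move=> _ _ /orP[]; [exists b, c | exists b, d].
by exists c, d.
Qed.

Let common_leaf x y x' y' : near x -> ~~ near y -> e x y ->
  near x' -> ~~ near y' -> e x' y' ->
  exists2 p, p \in leaves & e x p && e x' p.
Proof.
move=> nx fy xy nx' fy' xy'.
have [p [q [pL qL pq xp xq]]] := two_leaves nx fy xy.
have /orP[xp'|xq'] := near_misses_one_leaf nx' fy' xy' pL qL pq.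
  by exists p; rewrite ?xp.
by exists q; rewrite ?xq.
Qed.

(** [x] and [x'] share a leaf [r], since each misses at most one. A chair excludes the edge [y y'],
    and then a bull with [r] excludes [x x']. A chair centered at [r] makes [a] see one of [x],
    [x'], and a bull makes it see both; the leaves follow from [near_center_leaf]. *)
Lemma private_far_nbrs x y x' y' : near x -> ~~ near y -> e x y ->
  near x' -> ~~ near y' -> e x' y' -> ~~ e x y' -> ~~ e x' y ->
  [/\ ~~ e x x', {in a :: leaves, forall p, e p x}
    & {in a :: leaves, forall p, e p x'}].
Proof.
move=> nx fy xy nx' fy' xy' nxy' nxy.
have [r rL /andP[xr xr']] := common_leaf nx fy xy nx' fy' xy'.
have [nry nry'] := (far_leaf fy rL, far_leaf fy' rL).
have [[nay nay'] ar] := (far_center fy, far_center fy', a_leaf rL).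
have nyy' : ~~ e y y'.
  have [p [q [pL qL pq xp xq]]] := two_leaves nx fy xy.
  apply/negP=> yy'.
  by apply: (@chairF x p q y y') => //; by [apply: leafN | apply: far_leaf].
have nxx' : ~~ e x x'.
  apply/negP=> xx'.
  by apply: (@bullF y x x' y' r); by_adjacency.
have xa : e x a || e x' a.
  apply: contraT; rewrite negb_or => /andP[nxa nxa']; exfalso.
  have ax' : a != x' by apply: contraNneq nay' => ->.
  by apply: (@chairF r a x' x y); by_adjacency.
have both : e x a && e x' a.
  apply: contraT; rewrite negb_and => nxa; exfalso.
  case/orP: xa nxa => xa; rewrite xa /= ?orbF => nxa.
    by apply: (@bullF y x r x' a); by_adjacency.
  by apply: (@bullF y' x' r x a); by_adjacency.
case/andP: both => {}xa xa'; split=> // p; rewrite inE => /predU1P[->|pL];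
  rewrite e_sym //; first exact: near_center_leaf fy xy xa pL.
exact: near_center_leaf fy' xy' xa' pL.
Qed.

(** A vertex [z] at distance 3 from the claw would end the long leg [u], [z] of a chair centered at
    [x], with two leaves of the claw as its other leaves. *)
Lemma far_has_near_nbr y : connected_graph e -> ~~ near y ->
  exists2 x, near x & e x y.
Proof.
move=> conn fy; pose R := [pred u | near u || [exists x, near x && e x u]].
have clR : closed e R.
  apply: (intro_closed (sym_connect_sym e_sym)) => u z uz; rewrite !inE.
  have [nz //|fz /=] := boolP (near z).
  have [nu _|fu /= /existsP[x /andP[nx xu]]] := boolP (near u).
    by apply/existsP; exists u; rewrite nu.
  apply/existsP; exists x; rewrite nx /=; apply: contraT => nxz; exfalso.
  have [p [q [pL qL pq xp xq]]] := two_leaves nx fu xu.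
  by apply: (@chairF x p q u z) => //; by [apply: leafN | apply: far_leaf].
have: y \in R by rewrite -(closed_connect clR (conn a y)) inE near_claw ?mem_head.
by rewrite inE (negbTE fy) => /existsP[x /andP[nx xy]]; exists x.
Qed.

Lemma claw_dominating : connected_graph e -> exists2 S : {set T}, #|S| <= 5 &
  forall u, exists2 s, s \in S & (u == s) || e u s.
Proof.
move=> conn.
have [/exists_inP[x nx /forall_inP domx]|none] :=
  boolP [exists x in near, forall y in [predC near], e x y].
  exists [set:: [:: a; b; c; d; x]].
    by rewrite cardsE; apply: card_size.
  move=> u; have [/hasP[p pC up]|fu] := boolP (near u).
    exists p; rewrite ?up ?orbT // inE.
    by move: pC; rewrite !inE => /or4P[] ->; rewrite ?orbT.
  by exists x; rewrite ?inE ?eqxx ?orbT // e_sym domx ?orbT.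
pose D x := [set y | ~~ near y && e x y].
have na : near a by rewrite near_claw ?mem_head.
have [x nx maxx] := @arg_maxnP _ a near (fun x => #|D x|) na.
(* By the choice of [x], its far neighbourhood cannot be properly contained in that of [z]. *)
have maxP z f : near z -> ~~ near f -> e z f -> ~~ e x f ->
  exists y, [/\ ~~ near y, e x y & ~~ e z y].
  move=> nz ff zf xf.
  have /subsetPn[y] : ~~ (D x \subset D z).
    apply: contraTN (maxx z nz) => sub; rewrite -ltnNge proper_card //.
    by apply/properP; split=> //; exists f; rewrite inE ff ?zf // (negbTE xf).
  by rewrite !inE => /andP[fy xy]; rewrite fy /= => zy; exists y.
have [y' fy' xy'] : exists2 y', ~~ near y' & ~~ e x y'.
  have := none; rewrite negb_exists_in => /forall_inP/(_ x nx).
  by rewrite negb_forall_in => /exists_inP[y' fy' xy']; exists y'.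
have [x' nx' xy''] := far_has_near_nbr conn fy'.
have [y [fy xy x'y]] := maxP x' y' nx' fy' xy'' xy'.
have [nxx' xC xC'] := private_far_nbrs nx fy xy nx' fy' xy'' xy' x'y.
exists [set:: [:: x; x'; a]]; first by rewrite cardsE (leq_trans (card_size _)).
move=> u.
have [/exists_inP[s sS us]|udom] :=
  boolP [exists s in [set:: [:: x; x'; a]], (u == s) || e u s].
  by exists s.
exfalso.
have undom s : s \in [:: x; x'; a] -> (s != u) /\ ~~ e s u.
  move=> sS; have := udom; rewrite negb_exists_in => /forall_inP/(_ s).
  by rewrite inE sS negb_or eq_sym e_sym => /(_ isT)/andP[].
have [xu nxu] := undom x (mem_head _ _).
have [] := undom x'; first by rewrite !inE eqxx orbT.
move=> xu' nxu'.
have [] := undom a; first by rewrite !inE eqxx !orbT.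
move=> _ nau.
(* A near [u] sees a leaf [p], and chairs centered at [p] make it see [y] and [y']. Since [x] misses
   [y'], [x] and [u] have private far neighbours, so [u] sees [a] after all. *)
have [nu|fu] := boolP (near u).
  have [p pL up] : exists2 p, p \in leaves & e u p.
    case/hasP: nu => p; rewrite inE => /predU1P[->|pL up]; last by exists p.
    by rewrite e_sym (negbTE nau).
  have pC : p \in a :: leaves by rewrite inE pL orbT.
  have [px px'] := (xC p pC, xC' p pC).
  have [npy npy'] := (far_leaf fy pL, far_leaf fy' pL).
  have uy : e u y.
    apply: contraT => nuy; exfalso.
    by apply: (@chairF p x' u x y); by_adjacency.
  have uy' : e u y'.
    apply: contraT => nuy'; exfalso.
    by apply: (@chairF p x u x' y'); by_adjacency.
  have [z [fz xz uz]] := maxP u y' nu fy' uy' xy'.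
  have [_ _ /(_ a (mem_head _ _))] := private_far_nbrs nx fz xz nu fy' uy' xy' uz.
  exact/negP.
(* For a far [u], [v] and [x] have private far neighbours [u] and [z], so [v] is complete to the
   claw and misses [x]. Around [b] there is then a bull or a chair, according to whether [x'] sees
   [v]. *)
have [v nv vu] := far_has_near_nbr conn fu.
have [z [fz xz vz]] := maxP v u nv fu vu nxu.
have [nxv _ vC] := private_far_nbrs nx fz xz nv fu vu nxu vz.
have bC : b \in a :: leaves by rewrite !inE eqxx orbT.
have [[bx bx'] bv] := (xC b bC, xC' b bC, vC b bC).
have nbu : ~~ e b u by rewrite far_claw.
have xx' : x != x' by apply: contraNneq xy' => ->.
have [xv'|nxv'] := boolP (e x' v).
  by apply: (@bullF u v b x x'); by_adjacency.
by apply: (@chairF b x x' v u); by_adjacency.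
Qed.

End Claw.

End BullChairFree.

Theorem theorem3p9 (T : finType) (e : rel T) :
  simple_graph e -> connected_graph e -> bull_chair_free e -> lpt_le e 5.
Proof.
move=> [e_sym e_irr] conn [bullN chairN].
have bullF := bull_freeP e_sym e_irr bullN.
have chairF := chair_freeP e_sym e_irr chairN.
have [/existsP[[[[a b] c] d] cl]|clawN] :=
  boolP [exists q : T * T * T * T, claw e q.1.1.1 q.1.1.2 q.1.2 q.2].
  have [S cardS domS] := claw_dominating e_sym e_irr bullF chairF cl conn.
  by exists S; split=> //; apply: dominating_lp_transversal.
have {}clawN a b c d : ~~ claw e a b c d.
  by move: clawN; rewrite negb_exists => /forallP/(_ (a, b, c, d)).
(* Connectedness as defined allows the empty graph, which has no path at all. *)
case: (pickP T) => [x _|T0].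
  exists [set x]; split=> [|s longs]; first by rewrite cards1.
  exists x; first exact: set11.
  exact: claw_free_hamiltonian longs x.
by exists set0; split=> [|[|x s] []//]; [rewrite cards0 | have := T0 x].
Qed.
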